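(* Let $m>0$, $\beta>0$, and let $Z_{\mathcal X}$ be the partition function of the Gaussian free field without boundary on the Hamming graph $\mathcal X=\{0,1,\ldots,n-1\}^d$ with mass $m$, inverse temperature $\beta$ and interaction weights $J_1,\ldots,J_d$ (which may depend on $d,n$), with associated eigenvalues $\lambda_0,\ldots,\lambda_d$, as defined in the context. The free energy per particle, $-\frac1\beta\frac{\log Z_{\mathcal X}}{n^d}$, satisfies the following. (i) Fix $n$. Assume that there exists $\lambda_*=\lim_{d\to\infty}\lambda_{\lfloor(1-1/n)d\rfloor}$ and that for every $\epsilon>0$ there exists $\delta>0$ such that $\max_{i\in A_d(\epsilon)}|\lambda_i-\lambda_*|\to0$ as $d\to\infty$, where $A_d(\epsilon)=\{i\in\{0,1,\ldots,d\}:|i-(1-1/n)d|<\epsilon d^{1/2+\delta}\}$. Then $$-\frac1\beta\lim_{d\to\infty}\frac{\log Z_{\mathcal X}}{n^d}=\frac1{2\beta}\left\{\log(1+m^2-\lambda_* )-\log\Big(\frac{2\pi}\beta\Big)\right\}.$$ (ii) Fix $d$. Assume that there exists $\lambda_\#=\lim_{n\to\infty}\lambda_d$. Then $$-\frac1\beta\lim_{n\to\infty}\frac{\log Z_{\mathcal X}}{n^d}=\frac1{2\beta}\left\{\log(1+m^2-\lambda_\#)-\log\Big(\frac{2\pi}\beta\Big)\right\}.$$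
   Context: $d,n\ge2$; $\rho(x,x')=|\{i:x_i\ne x_i'\}|$ is the Hamming distance; $R_i=\{(x,x')\in\mathcal X\times\mathcal X:\rho(x,x')=i\}$ (ordered pairs); $\kappa_i=\binom di(n-1)^i$. Weights $J_i\ge0$, $i=1,\ldots,d$, satisfy $\sum_{i=1}^d\kappa_iJ_i\le1$ and do not depend on $m$ or $\beta$. The Hamiltonian is $H\{(\xi_x)\}=\frac14\sum_{i=1}^dJ_i\sum_{(x,x')\in R_i}(\xi_x-\xi_{x'})^2+\frac{m^2}2\sum_{x\in\mathcal X}\xi_x^2$; the partition function is $Z_{\mathcal X}=\int_{\mathbb R^{\mathcal X}}e^{-\beta H\{(\xi_x)\}}\prod_{x\in\mathcal X}d\xi_x$. Put $w_i=\kappa_iJ_i$ for $1\le i\le d$, $w_0=1-\sum_{i=1}^dw_i$, and $$\lambda_i=\sum_{j=0}^d\frac{w_j}{\kappa_j}K_j(i),\qquad K_i(j)=\sum_{l=\max(0,i+j-d)}^{\min(i,j)}(-1)^l(n-1)^{i-l}\binom jl\binom{d-j}{i-l}$$ (Krawtchouk polynomials). *)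

(* Defs.v *)
From HB Require Import structures.
From mathcomp Require Import all_boot all_order all_algebra.
From mathcomp Require Import all_classical all_reals all_analysis.

Set Implicit Arguments.
Unset Strict Implicit.
Unset Printing Implicit Defensive.

Import Order.TTheory GRing.Theory Num.Theory.
Import numFieldNormedType.Exports.

Local Open Scope classical_set_scope.
Local Open Scope ring_scope.

Section lebesgue_tuple.
Context {R : realType}.
Local Notation mR := (measurableTypeR R).

Definition tuple_cons (N : nat) (p : mR * N.-tuple mR) : N.+1.-tuple mR :=
  [the N.+1.-tuple mR of p.1 :: p.2].

Definition tuple_uncons (N : nat) (t : N.+1.-tuple mR) : mR * N.-tuple mR :=
  (thead t, [tuple of behead t]).

Lemma tuple_consK N : cancel (@tuple_cons N) (@tuple_uncons N).
Proof.
case=> x t; rewrite /tuple_uncons /tuple_cons /=; congr (_, _); exact: val_inj.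
Qed.

Lemma tuple_unconsK N : cancel (@tuple_uncons N) (@tuple_cons N).
Proof. by move=> t; rewrite [in RHS](tuple_eta t); exact: val_inj. Qed.

Lemma measurable_tuple_cons N : measurable_fun [set: _] (@tuple_cons N).
Proof. exact: measurable_cons. Qed.

Lemma measurable_tuple_uncons N : measurable_fun [set: _] (@tuple_uncons N).
Proof.
apply/measurable_fun_pair => /=; first exact: measurable_tnth.
exact: measurable_behead.
Qed.

Section lebesgue_cons.
Variables (N : nat) (mu : {sigma_finite_measure set (N.-tuple mR) -> \bar R}).
Local Open Scope ereal_scope.

Definition lebesgue_cons : set (N.+1.-tuple mR) -> \bar R :=
  pushforward (@lebesgue_measure R \x mu) (@tuple_cons N).

Let lebesgue_cons0 : lebesgue_cons set0 = 0.
Proof. by rewrite /lebesgue_cons /pushforward preimage_set0 measure0. Qed.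

Let lebesgue_cons_ge0 A : 0 <= lebesgue_cons A.
Proof. by rewrite /lebesgue_cons /pushforward; apply: measure_ge0. Qed.

Let lebesgue_cons_sigma_additive : semi_sigma_additive lebesgue_cons.
Proof.
have mf := @measurable_tuple_cons N.
move=> F mF tF mUF; rewrite /lebesgue_cons /pushforward preimage_bigcup.
apply: measure_semi_sigma_additive.
- by move=> n; rewrite -[X in measurable X]setTI; exact: mf.
- apply/trivIsetP => /= i j _ _ ij; rewrite -preimage_setI.
  by move/trivIsetP : tF => /(_ _ _ _ _ ij) ->//; rewrite preimage_set0.
- by rewrite -preimage_bigcup -[X in measurable X]setTI; exact: mf.
Qed.

HB.instance Definition _ := isMeasure.Build _ _ _ lebesgue_cons
  lebesgue_cons0 lebesgue_cons_ge0 lebesgue_cons_sigma_additive.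

Let lebesgue_cons_sigma_finite : sigma_finite setT lebesgue_cons.
Proof.
have /sigma_finiteP[F [TF ndF Foo]] := sigma_finiteT (@lebesgue_measure R).
have /sigma_finiteP[G [TG ndG Goo]] := sigma_finiteT mu.
exists (fun k => @tuple_uncons N @^-1` (F k `*` G k)).
  rewrite -preimage_bigcup (_ : \bigcup_k _ = setT) ?preimage_setT//.
  rewrite -setXTT TF TG predeqE => -[x y]; split; last first.
    by move=> /= [[n _ Fnx] [k _ Gky]]; exists (maxn n k) => //; split;
      [move: x Fnx; exact/subsetPset/ndF/leq_maxl
      |move: y Gky; exact/subsetPset/ndG/leq_maxr].
  by move=> [n _ []/= ? ?]; split; exists n.
move=> k; have [? ?] := Foo k; have [? ?] := Goo k; split.
  rewrite -[X in measurable X]setTI.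
  by apply: measurable_tuple_uncons => //; exact: measurableX.
rewrite /lebesgue_cons /pushforward (_ : _ @^-1` _ = F k `*` G k).
  by rewrite product_measure1E// lte_mul_pinfty// ge0_fin_numE.
by rewrite -comp_preimage (_ : _ \o _ = id)//; apply/funext/tuple_consK.
Qed.

HB.instance Definition _ := Measure_isSigmaFinite.Build _ _ _ lebesgue_cons
  lebesgue_cons_sigma_finite.

End lebesgue_cons.

(* Lebesgue measure on R^N, as the N-fold product of the Lebesgue measure on R;
   see lebesgue_tuple_box for its value on boxes *)
Fixpoint lebesgue_tuple (N : nat) :
    {sigma_finite_measure set (N.-tuple mR) -> \bar R} :=
  match N with
  | 0%N => @dirac _ (0.-tuple mR) [tuple] R
  | M.+1 => lebesgue_cons (lebesgue_tuple M)
  end.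

Local Open Scope ereal_scope.

Lemma lebesgue_tuple_box N (A : 'I_N -> set mR) :
  (forall i, measurable (A i)) ->
  lebesgue_tuple N [set t | forall i, A i (tnth t i)] =
  \prod_(i < N) lebesgue_measure (A i).
Proof.
elim: N A => [|N IH] A mA.
  by rewrite big_ord0 /= diracE mem_set//= => -[].
rewrite big_ord_recl/= /lebesgue_cons /pushforward.
rewrite [X in product_measure1 _ _ X](_ : _ = A ord0 `*`
    [set t : N.-tuple mR | forall i, A (lift ord0 i) (tnth t i)]); last first.
  apply/seteqP; split => -[x t] /=.
    by move=> h; split=> [|i]; [exact: (h ord0)|have := h (lift ord0 i); rewrite tnthS].
  move=> [A0 h] i; have [j ->|->] := unliftP ord0 i; last exact: A0.
  by rewrite tnthS; exact: h.
rewrite product_measure1E//=.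
  by congr (_ * _); exact: (IH (fun i => A (lift ord0 i))).
rewrite (_ : [set t | _] =
    \bigcap_(i in [set: 'I_N]) (fun t => tnth t i) @^-1` A (lift ord0 i)).
  apply: fin_bigcap_measurable => // i _.
  by rewrite -[X in measurable X]setTI; exact: measurable_tnth.
by apply/seteqP; split => t /= h i; [move=> _; exact: h|exact: (h i)].
Qed.

End lebesgue_tuple.

Section hamming.
Variables (d n : nat).

Definition hamming_vertex : finType := {ffun 'I_d -> 'I_n}.

Definition hamming_dist (x y : hamming_vertex) : nat := #|[set i | x i != y i]%SET|.

Definition hamming_rel (i : nat) : {set hamming_vertex * hamming_vertex} :=
  [set p | hamming_dist p.1 p.2 == i]%SET.

Definition hamming_valency (i : nat) : nat := 'C(d, i) * (n - 1) ^ i.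

End hamming.

Section gff.
Context {R : realType}.
Variables (d n : nat) (J : nat -> R).

(* In the lower bound, truncated subtraction on nat gives max(0, i + j - d) *)
Definition krawtchouk (i j : nat) : R :=
  \sum_(i + j - d <= l < (minn i j).+1)
    (-1) ^+ l * (n%:R - 1) ^+ (i - l) * 'C(j, l)%:R * 'C(d - j, i - l)%:R.

(* J 0 is never used *)
Definition gff_weight (i : nat) : R :=
  if i == 0%N then 1 - \sum_(1 <= j < d.+1) (hamming_valency d n j)%:R * J j
  else (hamming_valency d n i)%:R * J i.

Definition gff_eigenvalue (i : nat) : R :=
  \sum_(0 <= j < d.+1)
    gff_weight j / (hamming_valency d n j)%:R * krawtchouk j i.

Definition gff_hamiltonian (m : R) (xi : hamming_vertex d n -> R) : R :=
  4^-1 * (\sum_(1 <= i < d.+1)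
            J i * \sum_(p in hamming_rel d n i) (xi p.1 - xi p.2) ^+ 2)
  + m ^+ 2 / 2 * \sum_x xi x ^+ 2.

(* R^X is identified with R^#|X| through the enumeration of X *)
Definition field_of_tuple (t : #|hamming_vertex d n|.-tuple (measurableTypeR R))
    (x : hamming_vertex d n) : R := tnth t (enum_rank x).

(* For m, beta > 0 and J >= 0 the integrand is a Gaussian density up to a
   factor, so its integral is finite and no information is lost in taking
   the real-valued integral *)
Definition gff_partition (m beta : R) : R :=
  \int[lebesgue_tuple #|hamming_vertex d n|]_t
    expR (- beta * gff_hamiltonian m (field_of_tuple t)).

End gff.

(* Main.v *)
(* The Hamiltonian is half the quadratic form of (1 + m^2) I - W, where W is the
   stochastic matrix sum_j w_j / kappa_j A_j and A_j is the adjacency matrix at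
   distance j.  A tensor-power basis, indexed by the vertices y, diagonalizes
   every A_j; its eigenvalue is the coefficient of X^j in
   (1 + (n - 1) X)^(d - |y|) (1 - X)^|y|, the Krawtchouk polynomial K_j(|y|), with
   |y| the number of nonzero coordinates of y.  The Gaussian integral therefore
   gives
     log Z / n^d = (log (2 pi / beta) - E[log (1 + m^2 - lambda_|y|)]) / 2,
   the mean being over a uniform vertex y.  Since |lambda_i| <= 1, the logarithm is
   m^-2-Lipschitz on the relevant range, so it suffices that |y| lies, with
   probability tending to 1, where lambda is close to its limit: by Chebyshev's
   inequality |y| is within d^(1/2 + delta) of its mean (1 - 1/n) d as d grows,
   and |y| = d with probability (1 - 1/n)^d -> 1 as n grows. *)
Require Import Defs.
From HB Require Import structures.
From mathcomp Require Import all_boot all_order all_algebra.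
From mathcomp Require Import all_classical all_reals all_analysis.
From mathcomp Require Import measurable_realfun.
From mathcomp Require Import ring lra zify.

Set Implicit Arguments.
Unset Strict Implicit.

Import Order.TTheory GRing.Theory Num.Theory.
Import numFieldNormedType.Exports.

Local Open Scope classical_set_scope.
Local Open Scope ring_scope.

(** * Gaussian integrals of positive definite quadratic forms, by Schur complements *)

Definition quad_form {R : realType} {N : nat} (M : 'M[R]_N) (x : 'I_N -> R) : R :=
  \sum_i \sum_j M i j * x i * x j.

Definition schur {R : realType} {N : nat} (M : 'M[R]_N.+1) : 'M[R]_N :=
  \matrix_(i, j) (M (lift ord0 i) (lift ord0 j)
    - M (lift ord0 i) ord0 / M ord0 ord0 * M ord0 (lift ord0 j)).

Definition posdef {R : realType} {N : nat} (M : 'M[R]_N) : Prop :=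
  forall x : 'I_N -> R, (exists i, x i != 0) -> 0 < quad_form M x.

(** Left multiplication by the unipotent matrix [L] clears the first column below the pivot and
    leaves a block upper triangular matrix. *)
Lemma det_schur {R : realType} {N : nat} (M : 'M[R]_N.+1) :
  M ord0 ord0 != 0 -> \det M = M ord0 ord0 * \det (schur M).
Proof.
move=> a0; pose A : 'M[R]_(1 + N) := M.
pose L : 'M[R]_(1 + N) :=
  block_mx 1%:M 0 (- (M ord0 ord0)^-1 *: dlsubmx A) 1%:M.
have detL : \det L = 1 by rewrite det_lblock !det1 mulr1.
have -> : \det M = \det (L *m A) by rewrite det_mulmx detL mul1r.
rewrite -[A]submxK mulmx_block !mul1mx !mul0mx !addr0.
rewrite (_ : _ *m ulsubmx A + _ = 0); last first.
  apply/matrixP => i j; rewrite !mxE big_ord1 !mxE !ord1.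
  rewrite (_ : lshift N 0 = ord0) ?mulNr; last exact: val_inj.
  by rewrite /A /= -mulrA (mulrC _ (M ord0 ord0)) mulrA mulVf// mul1r addNr.
rewrite det_ublock det_mx11 !mxE (_ : lshift N 0 = ord0); last exact: val_inj.
congr (_ * \det _); apply/matrixP => i j; rewrite !mxE big_ord1 !mxE.
rewrite !rshift1 (_ : lshift N 0 = ord0); last exact: val_inj.
by rewrite /A addrC !mulNr (mulrC (_^-1)).
Qed.

Lemma quad_form_recl {R : realType} {N : nat} (M : 'M[R]_N.+1) (x : 'I_N.+1 -> R) :
  M^T = M ->
  quad_form M x = M ord0 ord0 * x ord0 ^+ 2
    + 2 * x ord0 * (\sum_j M ord0 (lift ord0 j) * x (lift ord0 j))
    + \sum_i \sum_j M (lift ord0 i) (lift ord0 j) * x (lift ord0 i) * x (lift ord0 j).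
Proof.
move=> sM; rewrite /quad_form big_ord_recl big_ord_recl.
under [in X in _ + X = _]eq_bigr do rewrite big_ord_recl.
rewrite big_split /= (_ : \sum_(i < N) M ord0 (lift ord0 i) * x ord0 * x (lift ord0 i) =
   x ord0 * \sum_(j < N) M ord0 (lift ord0 j) * x (lift ord0 j)); last first.
  by rewrite mulr_sumr; apply: eq_bigr => i _; ring.
rewrite (_ : \sum_(i < N) M (lift ord0 i) ord0 * x (lift ord0 i) * x ord0 =
   x ord0 * \sum_(j < N) M ord0 (lift ord0 j) * x (lift ord0 j)); last first.
  by rewrite mulr_sumr; apply: eq_bigr => i _; rewrite -[in LHS]sM mxE; ring.
by ring.
Qed.

(** The square is completed in the coordinate [ord0]; symmetry merges the two cross terms into
    one. *)
Lemma quad_form_schur {R : realType} {N : nat} (M : 'M[R]_N.+1) (x : 'I_N.+1 -> R) :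
  M^T = M -> M ord0 ord0 != 0 ->
  quad_form M x =
    M ord0 ord0 * (x ord0 +
      (M ord0 ord0)^-1 * \sum_j M ord0 (lift ord0 j) * x (lift ord0 j)) ^+ 2
    + quad_form (schur M) (fun i => x (lift ord0 i)).
Proof.
move=> sM a0; rewrite quad_form_recl//.
set b := \sum_j M ord0 _ * _.
rewrite (_ : quad_form _ _ = (\sum_i \sum_j M (lift ord0 i) (lift ord0 j)
    * x (lift ord0 i) * x (lift ord0 j)) - b ^+ 2 / M ord0 ord0).
  by set c := \sum_i _; field.
rewrite /b expr2 mulr_suml mulr_suml -sumrB; apply: eq_bigr => i _.
rewrite mulr_sumr mulr_suml -sumrB; apply: eq_bigr => j _.
by rewrite mxE -[in X in X / _]sM [in X in X / _]mxE; ring.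
Qed.

Lemma posdef_diag0 {R : realType} {N : nat} (M : 'M[R]_N.+1) :
  posdef M -> 0 < M ord0 ord0.
Proof.
move=> pM; have : 0 < quad_form M (fun i => (i == ord0)%:R).
  by apply: pM; exists ord0; rewrite eqxx oner_neq0.
rewrite /quad_form (bigD1 ord0)//= [X in _ + X]big1 ?addr0; last first.
  by move=> i /negPf ->; rewrite big1// => j _; rewrite mulr0 mul0r.
rewrite (bigD1 ord0)//= big1 ?addr0 ?mulr1//.
by move=> i /negPf ->; rewrite mulr0.
Qed.

(** A vector [y] is extended at [ord0] by the value that makes the completed square vanish, so that
    both forms agree on it. *)
Lemma posdef_schur {R : realType} {N : nat} (M : 'M[R]_N.+1) :
  M^T = M -> posdef M -> posdef (schur M).
Proof.
move=> sM pM y [i yi]; have a0 := posdef_diag0 pM.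
pose b := \sum_j M ord0 (lift ord0 j) * y j.
pose x j := if unlift ord0 j is Some k then y k else - ((M ord0 ord0)^-1 * b).
have xl j : x (lift ord0 j) = y j by rewrite /x liftK.
have x0 : x ord0 = - ((M ord0 ord0)^-1 * b) by rewrite /x unlift_none.
have := pM x; rewrite quad_form_schur ?gt_eqF//.
have -> : \sum_j M ord0 (lift ord0 j) * x (lift ord0 j) = b.
  by apply: eq_bigr => j _; rewrite xl.
rewrite x0 addNr expr0n mulr0 add0r.
under [fun i => x _]eq_fun do rewrite xl.
by apply; exists (lift ord0 i); rewrite xl.
Qed.

Lemma schur_sym {R : realType} {N : nat} (M : 'M[R]_N.+1) :
  M^T = M -> (schur M)^T = schur M.
Proof.
move=> sM; apply/matrixP => i j; rewrite !mxE.
have e k l : M k l = M l k by rewrite -[in LHS]sM mxE.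
pose l (k : 'I_N) : 'I_N.+1 := lift ord0 k.
by rewrite (e (l j) (l i)) (e (l j) ord0) (e ord0 (l i)); ring.
Qed.

Lemma measurable_gauss_shift {R : realType} (a c : R) :
  measurable_fun [set: measurableTypeR R]
    (fun x : measurableTypeR R => (expR (- 2^-1 * (a * (x + c) ^+ 2)))%:E).
Proof.
apply/measurable_EFinP; apply: measurableT_comp => //.
apply: measurable_funM => //; apply: measurable_funM => //.
by apply: measurable_funX; exact: measurable_funD.
Qed.

(** The integrand is the right-hand side times the normal density of mean [- c] and variance
    [a^-1]. *)
Lemma integral_gauss_shift {R : realType} (a c : R) : 0 < a ->
  (\int[lebesgue_measure]_x (expR (- 2^-1 * (a * (x + c) ^+ 2)))%:E
     = (Num.sqrt (2 * pi / a))%:E)%E.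
Proof.
move=> a0; pose s : R := Num.sqrt a^-1.
have s0 : s != 0 by rewrite gt_eqF// sqrtr_gt0 invr_gt0.
have s2 : s ^+ 2 = a^-1 by rewrite sqr_sqrtr// invr_ge0 ltW.
transitivity (\int[lebesgue_measure]_x
    ((Num.sqrt (2 * pi / a))%:E * (normal_pdf (- c) s x)%:E))%E.
  apply: eq_integral => x _; rewrite -EFinM normal_pdfE//; congr EFin.
  rewrite /normal_peak /normal_fun s2 opprK.
  rewrite (_ : a^-1 * pi *+ 2 = 2 * pi / a); last by rewrite -mulr_natl; ring.
  rewrite [RHS]mulrA divff ?mul1r; last first.
    by rewrite gt_eqF// sqrtr_gt0 divr_gt0// mulr_gt0// pi_gt0.
  by congr expR; field; rewrite gt_eqF.
rewrite ge0_integralZl//.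
- by rewrite integral_normal_pdf mule1.
- by apply/measurable_EFinP; exact: measurable_normal_pdf.
- by move=> x _; rewrite lee_fin normal_pdf_ge0.
Qed.

Lemma measurable_quad_form {R : realType} {N : nat} (M : 'M[R]_N) :
  measurable_fun [set: N.-tuple (measurableTypeR R)]
    (fun t : N.-tuple (measurableTypeR R) => quad_form M (tnth t) : measurableTypeR R).
Proof.
apply: measurable_sum => i; apply: measurable_sum => j.
by do 2 (apply: measurable_funM; last exact: measurable_tnth).
Qed.

Lemma measurable_expR_quad_form {R : realType} {N : nat} (M : 'M[R]_N) :
  measurable_fun [set: N.-tuple (measurableTypeR R)]
    (fun t : N.-tuple (measurableTypeR R) => (expR (- 2^-1 * quad_form M (tnth t)))%:E).
Proof.
apply/measurable_EFinP; apply: measurableT_comp => //.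
by apply: measurable_funM => //; exact: measurable_quad_form.
Qed.

(** Tonelli's theorem, in the order that integrates the first coordinate innermost, as completing
    the square requires. *)
Lemma integral_lebesgue_cons {R : realType} {N : nat}
    (f : N.+1.-tuple (measurableTypeR R) -> \bar R) :
  measurable_fun setT f -> (forall t, 0 <= f t)%E ->
  (\int[lebesgue_tuple N.+1]_t f t =
   \int[lebesgue_tuple N]_t \int[lebesgue_measure]_x f (tuple_cons (x, t)))%E.
Proof.
move=> mf f0 /=; rewrite ge0_integral_pushforward//; last exact: measurable_tuple_cons.
rewrite preimage_setT (@fubini_tonelli2 _ _ _ _ _ lebesgue_measure
  (lebesgue_tuple N) (f \o @tuple_cons R N))//.
  by apply: measurableT_comp => //; exact: measurable_tuple_cons.
by move=> x /=.
Qed.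

(* By induction on N: completing the square in the first coordinate leaves
   the Gaussian integral of the Schur complement. *)
Lemma integral_gauss_quad_form {R : realType} {N : nat} (M : 'M[R]_N) :
  M^T = M -> posdef M ->
  (0 < \det M) /\
  (\int[lebesgue_tuple N]_t (expR (- 2^-1 * quad_form M (tnth t)))%:E =
     (Num.sqrt ((2 * pi) ^+ N / \det M))%:E)%E.
Proof.
elim: N M => [M _ _|N IH M sM pM].
  rewrite det_mx00; split => //=.
  rewrite integral_dirac//; last exact: measurable_expR_quad_form.
  rewrite diracT mul1e /quad_form big_ord0 mulr0 expR0.
  by rewrite expr0 divr1 sqrtr1.
have a0 := posdef_diag0 pM.
have [d0 IHS] := IH _ (schur_sym sM) (posdef_schur sM pM).
rewrite det_schur ?gt_eqF//; split; first exact: mulr_gt0.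
rewrite integral_lebesgue_cons; [|exact: measurable_expR_quad_form|
  by move=> t; rewrite lee_fin expR_ge0].
transitivity (\int[lebesgue_tuple N]_t ((Num.sqrt (2 * pi / M ord0 ord0))%:E *
   (expR (- 2^-1 * quad_form (schur M) (tnth t)))%:E))%E.
  apply: eq_integral => t _.
  rewrite -(@integral_gauss_shift _ _
    ((M ord0 ord0)^-1 * \sum_j M ord0 (lift ord0 j) * tnth t j))//.
  rewrite -ge0_integralZr//; last exact: measurable_gauss_shift.
  apply: eq_integral => x _; rewrite -EFinM -expRD -mulrDr.
  congr ((expR (_ * _))%:E); rewrite quad_form_schur ?gt_eqF//.
  congr (_ * (_ + _ * _) ^+ 2 + _).
  - by apply: eq_bigr => j _; rewrite tnthS.
  - by apply: eq_bigr => i _; apply: eq_bigr => j _; rewrite !tnthS.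
rewrite ge0_integralZl//; last exact: measurable_expR_quad_form.
rewrite IHS -EFinM -sqrtrM; last by rewrite divr_ge0 ?mulr_ge0 ?pi_ge0// ltW.
congr (Num.sqrt _)%:E; rewrite exprS; field.
by rewrite !gt_eqF.
Qed.

(** * Krawtchouk polynomials through their generating function *)

Lemma coef_exp1ZX {R : comNzRingType} (c : R) (k i : nat) :
  ((1 + c *: 'X) ^+ k)`_i = c ^+ i *+ 'C(k, i).
Proof.
rewrite exprDn coef_sum.
under eq_bigr do rewrite expr1n mul1r exprZn coefMn coefZ coefXn.
have [ik|ki] := ltnP i k.+1.
  rewrite (bigD1 (Ordinal ik))//= eqxx mulr1 big1 ?addr0// => j jk.
  by rewrite eq_sym -(inj_eq val_inj)/= in jk; rewrite (negPf jk) mulr0 mul0rn.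
rewrite bin_small// mulr0n big1// => j _.
by rewrite gtn_eqF ?mulr0 ?mul0rn// (leq_trans (ltn_ord j)).
Qed.

(** Both powers are expanded by the binomial theorem. The indices [l] of the Cauchy product outside
    the bounds of the definition contribute zero, because ['C(j, l)] or ['C(d - j, i - l)] vanishes
    there. *)
Lemma krawtchouk_coef {R : realType} (d n i j : nat) : (j <= d)%N ->
  krawtchouk (R := R) d n i j =
    ((1 + (n%:R - 1) *: 'X) ^+ (d - j) * (1 - 'X) ^+ j)`_i.
Proof.
move=> jd; rewrite mulrC coefM.
have -> : (1 - 'X) = 1 + (- 1) *: 'X :> {poly R} by rewrite scaleN1r.
under [RHS]eq_bigr => l _ do rewrite !coef_exp1ZX.
rewrite /krawtchouk (big_nat_widen _ _ i.+1); last by rewrite ltnS geq_minl.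
rewrite (big_nat_widenl _ 0)//= big_mkord [RHS](bigID
  (fun l : 'I_i.+1 => (l < (minn i j).+1) && (i + j - d <= l)))%N /=.
rewrite [X in _ = _ + X]big1 ?addr0.
  by apply: eq_bigr => l _; rewrite [RHS]mulrnAl [in RHS]mulrnAr !mulr_natr mulrnAC.
move=> l; rewrite negb_and -leqNgt -ltnNge => /orP[lj|lj].
  by rewrite bin_small ?mulr0n ?mul0r//; have := ltn_ord l; lia.
by rewrite [in X in _ * X]bin_small ?mulr0n ?mulr0//; have := ltn_ord l; lia.
Qed.

(** Taking absolute values termwise and raising [n ^ (i - l)] to [n ^ i] leaves a Vandermonde sum
    equal to ['C(d, i)]. *)
Lemma normr_krawtchouk {R : realType} (d n i j : nat) :
  (0 < n)%N -> (j <= d)%N ->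
  `|krawtchouk (R := R) d n.+1 i j| <= (hamming_valency d n.+1 i)%:R.
Proof.
move=> n0 jd; rewrite krawtchouk_coef// mulrC coefM.
have -> : (1 - 'X) = 1 + (- 1) *: 'X :> {poly R} by rewrite scaleN1r.
apply: (le_trans (ler_norm_sum _ _ _)).
rewrite /hamming_valency -[in 'C(d, i)](subnKC jd) -binomial.Vandermonde.
rewrite natrM natr_sum mulr_suml.
apply: ler_sum => l _; rewrite !coef_exp1ZX normrM.
rewrite !normrMn !normrX normrN1 expr1n.
rewrite (_ : n.+1%:R - 1 = n%:R); last by rewrite -natr1 addrK.
rewrite normr_nat subSS subn0 -[X in X * _ <= _]mulr_natr mul1r.
rewrite natrM -[X in _ * X <= _]mulr_natr -mulrA ler_wpM2l ?ler0n//.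
rewrite mulrC ler_wpM2l ?ler0n// -natrX ler_nat.
by rewrite leq_pexp2l// leq_subr.
Qed.

(** * The tensor-power eigenbasis of the distance matrices *)

Section eigenbasis.
Context {R : realType} (d n : nat).
Local Notation V := (hamming_vertex d n.+1).

Definition hamming_weight (y : V) : nat := #|[set k | y k != ord0]%SET|.

(* The eigenbasis is the d-fold tensor power of the basis 1, e_b - e_0 of
   R^(n+1); its dual basis is the tensor power of the dual one. *)
Definition site_basis (a b : 'I_n.+1) : R :=
  if b == ord0 then 1 else (a == b)%:R - (a == ord0)%:R.

Definition site_dual (b a : 'I_n.+1) : R :=
  if b == ord0 then n.+1%:R^-1 else (a == b)%:R - n.+1%:R^-1.

Definition tensor (s : 'I_n.+1 -> 'I_n.+1 -> R) (x y : V) : R :=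
  \prod_k s (x k) (y k).

Lemma sum_delta_mull (T : finType) (b : T) (F : T -> R) :
  \sum_a (a == b)%:R * F a = F b.
Proof.
rewrite (bigD1 b)//= eqxx mul1r big1 ?addr0// => a /negPf ->.
by rewrite mul0r.
Qed.

Lemma sum_delta (T : finType) (b : T) : \sum_a (a == b)%:R = 1 :> R.
Proof.
by rewrite (bigD1 b)//= eqxx big1 ?addr0// => a /negPf ->.
Qed.

Lemma site_basisK (a b : 'I_n.+1) :
  \sum_c site_basis a c * site_dual c b = (a == b)%:R.
Proof.
rewrite (bigD1 ord0)//= {1}/site_basis {1}/site_dual eqxx mul1r.
rewrite (eq_bigr (fun c => ((a == c)%:R - (a == ord0)%:R)
    * ((b == c)%:R - n.+1%:R^-1))); last first.
  by move=> c /negPf c0; rewrite /site_basis /site_dual c0.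
(* In row [ord0] the [n.+1] copies of [n.+1%:R^-1] add up to 1, and the indicators over [c != ord0]
   remove all of it except [(ord0 == b)%:R]. In any other row the term at [c = a] cancels the
   [n.+1%:R^-1] or the 0 left over from its own shift. *)
have [->|a0] := eqVneq a ord0.
  rewrite (eq_bigr (fun c => n.+1%:R^-1 - (c == b)%:R)); last first.
    by move=> c /negPf c0; rewrite eq_sym c0 (eq_sym b) mulr1n mulr0n; ring.
  apply/eqP; rewrite -subr_eq0.
  have := sum_delta b; rewrite (bigD1 ord0)//= => h.
  rewrite sumrB sumr_const.
  have -> : \sum_(c < n.+1 | c != ord0) (c == b)%:R = 1 - (ord0 == b)%:R :> R.
    by apply/eqP; rewrite eq_sym subr_eq addrC h.
  have -> : #|[pred c : 'I_n.+1 | c != ord0]| = n.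
    by have := cardC1 (ord0 : 'I_n.+1); rewrite card_ord.
  apply/eqP; rewrite -[_ *+ n]mulr_natr -(natr1 n); field.
  by rewrite natr1 pnatr_eq0.
have := sum_delta_mull a (fun c => (b == c)%:R - n.+1%:R^-1).
rewrite (bigD1 ord0)//= eq_sym (negPf a0) mul0r add0r => h.
rewrite (eq_bigr (fun c => (c == a)%:R * ((b == c)%:R - n.+1%:R^-1))); last first.
  by move=> c _; rewrite subr0 (eq_sym a).
by rewrite h (eq_sym b); ring.
Qed.

(** Distributivity turns the sum over [z] into a product over sites, where a site at which [x] and
    [y] differ gives a zero factor. *)
Lemma tensor_basisK (x y : V) :
  \sum_z tensor site_basis x z * tensor site_dual z y = (x == y)%:R.
Proof.
under eq_bigr do rewrite -big_split /=.
rewrite -(bigA_distr_bigA (fun k c => site_basis (x k) c * site_dual c (y k))) /=.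
under eq_bigr do rewrite site_basisK.
have [->|xy] := eqVneq x y; first by apply: big1 => k _; rewrite eqxx.
have [k xyk] : exists k, x k != y k.
  apply/existsP; rewrite -[X in is_true X]negbK; apply: contra xy.
  rewrite negb_exists => /forallP h; apply/eqP/ffunP => k.
  by apply/eqP; have := h k; rewrite negbK.
by rewrite (bigD1 k)//= (negPf xyk) mul0r.
Qed.

(** The one-site matrix is [1 - 'X] times the identity plus ['X] times the all-ones matrix, which
    acts as [n.+1] on constants and as 0 on vectors of sum zero. *)
Lemma site_gen (x b : 'I_n.+1) :
  \sum_a 'X^(x != a) * (site_basis a b)%:P =
  (site_basis x b)%:P *
    (if b == ord0 then 1 + (n.+1%:R - 1) *: 'X else 1 - 'X) :> {poly R}.
Proof.
rewrite (bigD1 x)//= eqxx expr0 mul1r.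
rewrite (eq_bigr (fun a => 'X * (site_basis a b)%:P)); last first.
  by move=> a ax; rewrite eq_sym ax expr1.
rewrite -mulr_sumr -rmorph_sum /=.
have -> : \sum_(a | a != x) site_basis a b = (\sum_a site_basis a b) - site_basis x b.
  by rewrite [X in _ = X - _](bigD1 x)//= addrAC subrr add0r.
rewrite rmorphB /= /site_basis; case: ifP => b0.
  by rewrite sumr_const card_ord -mul_polyC !rmorphB /= !rmorph1 rmorph_nat; ring.
rewrite sumrB.
by rewrite !sum_delta subrr rmorph0; ring.
Qed.

(** All distances are handled at once: ['X^(hamming_dist x x')] is a product over sites, so
    [site_gen] applies site by site, and the coefficient of degree [i] is read off at the end. *)
Lemma krawtchouk_eigen (i : nat) (x y : V) :
  \sum_x' (hamming_dist x x' == i)%:R * tensor site_basis x' y =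
  krawtchouk d n.+1 i (hamming_weight y) * tensor site_basis x y.
Proof.
have wd : (hamming_weight y <= d)%N by rewrite -[X in (_ <= X)%N]card_ord max_card.
rewrite krawtchouk_coef//.
transitivity ((\sum_x' 'X^(hamming_dist x x') * (tensor site_basis x' y)%:P)`_i).
  rewrite coef_sum; apply: eq_bigr => x' _; rewrite coefMC coefXn.
  by rewrite eq_sym.
rewrite -coefMC; congr (polyseq _)`_i.
transitivity (\sum_(x' : V) \prod_k ('X^(x k != x' k) * (site_basis (x' k) (y k))%:P)).
  apply: eq_bigr => x' _; rewrite big_split /= -rmorph_prod; congr (_ * _).
  rewrite prodrXr; congr (_ ^+ _).
  rewrite /hamming_dist -sum1_card big_mkcond /=; apply: eq_bigr => k _.
  by rewrite inE; case: (_ != _).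
rewrite -(bigA_distr_bigA (fun k c => 'X^(x k != c) * (site_basis c (y k))%:P)) /=.
under eq_bigr do rewrite site_gen.
rewrite big_split /= -rmorph_prod mulrC; congr (_ * _).
rewrite (bigID (fun k => y k != ord0)) /= mulrC; congr (_ * _).
  rewrite (eq_bigr (fun=> 1 + (n.+1%:R - 1) *: 'X)); last by move=> k; rewrite negbK => ->.
  rewrite prodr_const; congr (_ ^+ _).
  have := cardsC [set k | y k != ord0]%SET.
  rewrite card_ord /hamming_weight => h; rewrite -[X in (X - _)%N]h addKn; apply: eq_card => k.
  by rewrite !inE.
rewrite (eq_bigr (fun=> 1 - 'X)); last by move=> k /negPf ->.
by rewrite prodr_const; congr (_ ^+ _); apply: eq_card => k; rewrite inE.
Qed.

(** The all-zero label [y0] has a constant basis vector, so its eigenvalue is the row sum. *)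
Lemma hamming_dist_sum (i : nat) (x : V) : (i <= d)%N ->
  \sum_x' (hamming_dist x x' == i)%:R = (hamming_valency d n.+1 i)%:R :> R.
Proof.
move=> id; pose y0 : V := [ffun=> ord0].
have b1 x' : tensor site_basis x' y0 = 1.
  by apply: big1 => k _; rewrite ffunE /site_basis eqxx.
have := krawtchouk_eigen i x y0; rewrite b1 mulr1.
under eq_bigr do rewrite b1 mulr1.
have -> : hamming_weight y0 = 0%N.
  by apply/eqP; rewrite cards_eq0; apply/eqP/setP => k; rewrite !inE ffunE eqxx.
move=> ->; rewrite krawtchouk_coef// subn0 expr0 mulr1 coef_exp1ZX.
rewrite /hamming_valency natrM mulrC subSS subn0 natrX mulr_natr.
by rewrite (_ : n.+1%:R - 1 = n%:R)// -natr1 addrK.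
Qed.

End eigenbasis.

Arguments site_basis {R n}.
Arguments site_dual {R n}.

(** * Determinants of matrices indexed by a finite type *)

Definition fun_mx {R : realType} (T : finType) (Q : T -> T -> R) : 'M[R]_#|T| :=
  \matrix_(i, j) Q (enum_val i) (enum_val j).

Lemma sum_enum_val {R : realType} (T : finType) (F : T -> R) :
  \sum_(i < #|T|) F (enum_val i) = \sum_x F x.
Proof. by rewrite [RHS](reindex _ (onW_bij _ (@enum_val_bij T))). Qed.

Lemma mul_fun_mx {R : realType} (T : finType) (P Q : T -> T -> R) :
  fun_mx P *m fun_mx Q = fun_mx (fun x y => \sum_z P x z * Q z y).
Proof.
apply/matrixP => i j; rewrite !mxE.
rewrite -[RHS]sum_enum_val.
by apply: eq_bigr => k _; rewrite !mxE.
Qed.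

(** [P'] certifies that the matrix of eigenvectors [P] is invertible, so its determinant cancels
    from the relation [QPD]. *)
Lemma det_eigenbasis {R : realType} (T : finType) (Q P P' : T -> T -> R) (e : T -> R) :
  (forall x y, \sum_z P x z * P' z y = (x == y)%:R) ->
  (forall x y, \sum_z Q x z * P z y = e y * P x y) ->
  \det (fun_mx Q) = \prod_x e x.
Proof.
move=> PP' QP.
have PP1 : fun_mx P *m fun_mx P' = 1%:M.
  rewrite mul_fun_mx; apply/matrixP => i j; rewrite !mxE PP'.
  by rewrite (inj_eq enum_val_inj).
have dP : \det (fun_mx P) != 0.
  apply/eqP => d0; have := congr1 determinant PP1.
  by rewrite det_mulmx d0 mul0r det1 => /esym/eqP; rewrite oner_eq0.
pose D : 'rV[R]_#|T| := \row_i e (enum_val i).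
have QPD : fun_mx Q *m fun_mx P = fun_mx P *m diag_mx D.
  rewrite mul_fun_mx mul_mx_diag; apply/matrixP => i j.
  by rewrite !mxE QP mulrC.
apply: (mulIf dP); rewrite -det_mulmx QPD det_mulmx mulrC det_diag; congr (_ * _).
rewrite [RHS](reindex _ (onW_bij _ (@enum_val_bij T))).
by apply: eq_bigr => i _; rewrite mxE.
Qed.

(** * The partition function in closed form *)

Section partition.
Context {R : realType} (d n : nat) (J : nat -> R).
Local Notation V := (hamming_vertex d n.+1).
Local Notation kappa i := ((hamming_valency d n.+1 i)%:R : R).

(** When the weights form a probability vector, this is the transition matrix of the walk that draws
    a distance [j] from it and moves to a uniform vertex at that distance. *)
Definition gff_transition (x x' : V) : R :=
  \sum_(0 <= j < d.+1) gff_weight d n.+1 J j / kappa j * (hamming_dist x x' == j)%:R.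

Lemma gff_transition_eigen (x y : V) :
  \sum_x' gff_transition x x' * tensor site_basis x' y =
  gff_eigenvalue d n.+1 J (hamming_weight y) * tensor site_basis x y.
Proof.
under eq_bigr do rewrite mulr_suml.
rewrite exchange_big /gff_eigenvalue mulr_suml; apply: eq_bigr => j _.
rewrite -mulrA -krawtchouk_eigen mulr_sumr.
by apply: eq_bigr => x' _; rewrite mulrA.
Qed.

Lemma hamming_distC (x x' : V) : hamming_dist x x' = hamming_dist x' x.
Proof. by apply: eq_card => k; rewrite !inE eq_sym. Qed.

Lemma hamming_dist_eq0 (x x' : V) : (hamming_dist x x' == 0%N) = (x == x').
Proof.
rewrite cards_eq0; apply/eqP/eqP => [h|->]; last by apply/setP => k; rewrite !inE eqxx.
apply/ffunP => k; move/setP: h => /(_ k); rewrite !inE => /negbT.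
by rewrite negbK => /eqP.
Qed.

Hypothesis n_gt0 : (0 < n)%N.

Lemma hamming_valency_neq0 (j : nat) : (j <= d)%N -> kappa j != 0.
Proof.
move=> jd; rewrite pnatr_eq0 /hamming_valency -lt0n muln_gt0 bin_gt0 jd/=.
by rewrite expn_gt0 subn1 n_gt0.
Qed.

Lemma gff_transitionE (x x' : V) :
  gff_transition x x' = gff_weight d n.+1 J 0 * (x == x')%:R +
    \sum_(1 <= j < d.+1) J j * (hamming_dist x x' == j)%:R.
Proof.
rewrite /gff_transition big_ltn// hamming_dist_eq0; congr (_ * _ + _).
  by rewrite /hamming_valency bin0 expn0 muln1 divr1.
rewrite big_seq [RHS]big_seq; apply: eq_bigr => j.
rewrite mem_index_iota ltnS => /andP[j1 jd]; rewrite /gff_weight gtn_eqF//.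
by congr (_ * _); rewrite mulrAC divff ?mul1r// hamming_valency_neq0.
Qed.

(** After expanding the square, each of the two pure squares contributes [kappa i] times the squared
    norm, since every vertex has [kappa i] vertices at distance [i]. *)
Lemma sum_hamming_rel (i : nat) (xi : V -> R) : (i <= d)%N ->
  \sum_(p in hamming_rel d n.+1 i) (xi p.1 - xi p.2) ^+ 2 =
  2 * (kappa i * \sum_x xi x ^+ 2)
  - 2 * \sum_x \sum_x' (hamming_dist x x' == i)%:R * xi x * xi x'.
Proof.
move=> id.
have e (F : V -> V -> R) : \sum_(p in hamming_rel d n.+1 i) F p.1 p.2 =
    \sum_x \sum_x' (hamming_dist x x' == i)%:R * F x x'.
  rewrite pair_big /= big_mkcond; apply: eq_bigr => -[x x'] _ /=.
  by rewrite inE /=; case: eqP => _; rewrite ?mul1r ?mul0r.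
rewrite (e (fun x x' => (xi x - xi x') ^+ 2)).
have s1 : \sum_x \sum_x' (hamming_dist x x' == i)%:R * xi x ^+ 2 =
    kappa i * \sum_x xi x ^+ 2.
  rewrite mulr_sumr; apply: eq_bigr => x _.
  by rewrite -mulr_suml hamming_dist_sum.
have s2 : \sum_x \sum_x' (hamming_dist x x' == i)%:R * xi x' ^+ 2 =
    kappa i * \sum_x xi x ^+ 2.
  rewrite -s1 exchange_big; apply: eq_bigr => x _; apply: eq_bigr => x' _.
  by rewrite hamming_distC.
rewrite [2 * (_ * _)](_ : _ = kappa i * \sum_x xi x ^+ 2 + kappa i * \sum_x xi x ^+ 2);
  last by ring.
rewrite -{1}s1 -s2 mulr_sumr -big_split -sumrB /=; apply: eq_bigr => x _.
rewrite mulr_sumr -big_split -sumrB /=; apply: eq_bigr => x' _; ring.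
Qed.

(** The inverse covariance matrix of the field: half its quadratic form is [beta] times the
    Hamiltonian. *)
Definition gff_precision (m beta : R) (x x' : V) : R :=
  beta * ((1 + m ^+ 2) * (x == x')%:R - gff_transition x x').

Lemma gff_hamiltonianE (m beta : R) (xi : V -> R) :
  \sum_x \sum_x' gff_precision m beta x x' * xi x * xi x' =
  2 * beta * gff_hamiltonian J m xi.
Proof.
pose S2 := \sum_x xi x ^+ 2.
pose C j := \sum_x \sum_x' (hamming_dist x x' == j)%:R * xi x * xi x'.
have diag (c : R) : \sum_x \sum_x' c * (x == x')%:R * xi x * xi x' = c * S2.
  rewrite mulr_sumr; apply: eq_bigr => x _.
  rewrite (eq_bigr (fun x' => (x' == x)%:R * (c * xi x * xi x'))) ?sum_delta_mull //.
    by rewrite expr2 mulrA.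
  by move=> x' _; rewrite eq_sym; ring.
have cross : \sum_x \sum_x' (\sum_(1 <= j < d.+1) J j * (hamming_dist x x' == j)%:R)
    * xi x * xi x' = \sum_(1 <= j < d.+1) J j * C j.
  rewrite [LHS](eq_bigr (fun x => \sum_(1 <= j < d.+1) \sum_x' J j *
     ((hamming_dist x x' == j)%:R * xi x * xi x'))); last first.
    move=> x _; rewrite exchange_big; apply: eq_bigr => x' _ /=.
    by rewrite !mulr_suml; apply: eq_bigr => j _; rewrite !mulrA.
  rewrite exchange_big; apply: eq_bigr => j _ /=; rewrite mulr_sumr.
  by apply: eq_bigr => x _; rewrite mulr_sumr.
(* The factor 2 from ordered pairs turns the prefactor [4^-1] into [2^-1]. *)
have ham : gff_hamiltonian J m xi = 2^-1 * ((\sum_(1 <= j < d.+1) kappa j * J j) * S2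
    - \sum_(1 <= j < d.+1) J j * C j) + m ^+ 2 / 2 * S2.
  rewrite /gff_hamiltonian; congr (_ + _).
  rewrite mulr_suml -sumrB !mulr_sumr big_seq [RHS]big_seq; apply: eq_bigr => j.
  rewrite mem_index_iota ltnS => /andP[_ jd].
  by rewrite sum_hamming_rel// -/S2 -/(C j); field.
rewrite ham /gff_precision.
transitivity (beta * ((1 + m ^+ 2 - gff_weight d n.+1 J 0) * S2
   - \sum_(1 <= j < d.+1) J j * C j)).
  rewrite -diag -cross -sumrB mulr_sumr; apply: eq_bigr => x _.
  rewrite -sumrB mulr_sumr; apply: eq_bigr => x' _.
  by rewrite gff_transitionE; ring.
(* One minus the weight at 0 is the total coupling, which is the diagonal part of the
   interaction. *)
by rewrite /gff_weight eqxx; field.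
Qed.

Lemma gff_precision_eigen (m beta : R) (x y : V) :
  \sum_z gff_precision m beta x z * tensor site_basis z y =
  beta * (1 + m ^+ 2 - gff_eigenvalue d n.+1 J (hamming_weight y))
    * tensor site_basis x y.
Proof.
rewrite -mulrA mulrBl -gff_transition_eigen.
rewrite -(sum_delta_mull x (fun z => tensor site_basis z y)).
rewrite mulr_sumr -sumrB mulr_sumr; apply: eq_bigr => z _.
by rewrite /gff_precision (eq_sym x); ring.
Qed.

Hypothesis J_ge0 : forall i, (1 <= i <= d)%N -> 0 <= J i.

(** The interaction is nonnegative, so the mass term alone yields positive definiteness of the
    precision matrix. *)
Lemma gff_hamiltonian_ge (m : R) (xi : V -> R) :
  m ^+ 2 / 2 * \sum_x xi x ^+ 2 <= gff_hamiltonian J m xi.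
Proof.
rewrite lerDr mulr_ge0// big_seq sumr_ge0// => i.
rewrite mem_index_iota ltnS => /J_ge0 Ji.
by rewrite mulr_ge0// sumr_ge0// => p _; rewrite sqr_ge0.
Qed.

Lemma quad_form_precision (m beta : R) (t : 'I_#|V| -> R) :
  quad_form (fun_mx (gff_precision m beta)) t =
  2 * beta * gff_hamiltonian J m (fun x => t (enum_rank x)).
Proof.
rewrite -gff_hamiltonianE /quad_form -[RHS]sum_enum_val; apply: eq_bigr => i _.
rewrite -[RHS]sum_enum_val; apply: eq_bigr => j _.
by rewrite mxE !enum_valK.
Qed.

Lemma gff_partitionE (m beta : R) : 0 < m -> 0 < beta ->
  gff_partition d n.+1 J m beta = Num.sqrt ((2 * pi) ^+ #|V| /
    \prod_(y : V) (beta * (1 + m ^+ 2 - gff_eigenvalue d n.+1 J (hamming_weight y)))).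
Proof.
move=> m0 b0; pose M := fun_mx (gff_precision m beta).
have detM : \det M = \prod_(y : V)
    (beta * (1 + m ^+ 2 - gff_eigenvalue d n.+1 J (hamming_weight y))).
  by apply: det_eigenbasis => x y; [exact: tensor_basisK|exact: gff_precision_eigen].
have sM : M^T = M.
  apply/matrixP => i j; rewrite !mxE /gff_precision eq_sym; congr (_ * (_ - _)).
  by rewrite /gff_transition; apply: eq_bigr => k _; rewrite hamming_distC.
have pM : posdef M.
  move=> t [i ti]; rewrite quad_form_precision !mulr_gt0//.
  apply: lt_le_trans (gff_hamiltonian_ge _ _).
  rewrite mulr_gt0 ?divr_gt0 ?exprn_gt0//.
  rewrite (bigD1 (enum_val i))//= enum_valK ltr_pwDl//.
    by rewrite exprn_even_gt0.
  by rewrite sumr_ge0// => x _; rewrite sqr_ge0.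
have [_] := integral_gauss_quad_form sM pM; rewrite detM => int.
rewrite /gff_partition /Rintegral -[RHS]/(fine (_%:E)) -int; congr fine.
apply: eq_integral => t _; congr (expR _)%:E.
by rewrite quad_form_precision; field.
Qed.

Hypothesis J_le1 : \sum_(1 <= i < d.+1) kappa i * J i <= 1.

(** The eigenvalue is an average, under the probability weights, of ratios of [krawtchouk] to
    valency, each in [-1, 1]. *)
Lemma normr_gff_eigenvalue (i : nat) : (i <= d)%N ->
  `|gff_eigenvalue d n.+1 J i| <= 1.
Proof.
move=> id; have w_ge0 j : (j <= d)%N -> 0 <= gff_weight d n.+1 J j.
  rewrite /gff_weight; case: j => [|j] jd /=; first by rewrite subr_ge0.
  by rewrite mulr_ge0// J_ge0.
apply: (le_trans (ler_norm_sum _ _ _)).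
apply: (@le_trans _ _ (\sum_(0 <= j < d.+1) gff_weight d n.+1 J j)).
  rewrite big_seq [leRHS]big_seq ler_sum// => j.
  rewrite mem_index_iota ltnS => /andP[_ jd].
  rewrite normrM ger0_norm ?divr_ge0 ?w_ge0// mulrAC.
  rewrite ler_pdivrMr; last by rewrite lt_neqAle eq_sym hamming_valency_neq0 /=.
  by rewrite ler_wpM2l ?w_ge0// normr_krawtchouk.
rewrite big_ltn// [X in _ + X](_ : _ = \sum_(1 <= j < d.+1) kappa j * J j).
  by rewrite /gff_weight eqxx subrK.
rewrite big_seq [RHS]big_seq; apply: eq_bigr => j.
by rewrite mem_index_iota /gff_weight => /andP[j1 _]; rewrite gtn_eqF.
Qed.

Lemma ln_gff_partition (m beta : R) : 0 < m -> 0 < beta ->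
  ln (gff_partition d n.+1 J m beta) =
  2^-1 * \sum_(y : V) (ln (2 * pi / beta)
    - ln (1 + m ^+ 2 - gff_eigenvalue d n.+1 J (hamming_weight y))).
Proof.
move=> m0 b0; rewrite gff_partitionE//.
pose lam (y : V) := 1 + m ^+ 2 - gff_eigenvalue d n.+1 J (hamming_weight y).
have lam_gt0 y : 0 < lam y.
  have wd : (hamming_weight y <= d)%N by rewrite -[X in (_ <= X)%N]card_ord max_card.
  have := normr_gff_eigenvalue wd; rewrite ler_norml => /andP[_ h].
  by have := exprn_gt0 2 m0; rewrite /lam; lra.
have c0 : 0 < 2 * pi / beta by rewrite divr_gt0// mulr_gt0// pi_gt0.
(* The power of [2 * pi] is spread over the vertices, so that each mode carries its own factor
   [2 * pi / beta / lam y]. *)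
rewrite -prodr_const -prodf_div.
rewrite (eq_bigr (fun y => 2 * pi / beta / lam y)); last first.
  by move=> y _; rewrite -/(lam y); field; rewrite !gt_eqF.
have [p_gt0 lnp] : 0 < \prod_y (2 * pi / beta / lam y) /\
    ln (\prod_y (2 * pi / beta / lam y)) = \sum_y (ln (2 * pi / beta) - ln (lam y)).
  elim/big_rec2: _ => [|y s p _ [p0 lnp]]; first by rewrite ln1.
  have q0 : 0 < 2 * pi / beta / lam y by rewrite divr_gt0.
  by rewrite mulr_gt0// lnM ?posrE// ln_div ?posrE// lnp.
rewrite -lnp -[in RHS](sqr_sqrtr (ltW p_gt0)) lnXn ?sqrtr_gt0//.
by rewrite -[X in _ = _ * X]mulr_natl mulrA mulVf ?mul1r.
Qed.

End partition.

(** * Concentration of the Hamming weight and the resulting free energy estimate *)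

Lemma ler_dist_ln {R : realType} (mu a b : R) :
  0 < mu -> mu <= a -> mu <= b -> `|ln a - ln b| <= `|a - b| / mu.
Proof.
move=> mu0.
(* This follows from [ln (1 + z) <= z] at [z = (x - y) / y], with [y] at least [mu]; exchanging [x]
   and [y] then gives the absolute value. *)
have half (x y : R) : mu <= x -> mu <= y -> ln x - ln y <= `|x - y| / mu.
  move=> mx my; have x0 := lt_le_trans mu0 mx; have y0 := lt_le_trans mu0 my.
  rewrite -ln_div ?posrE//.
  have -> : x / y = 1 + (x - y) / y by field; rewrite gt_eqF.
  apply: (@le_trans _ _ ((x - y) / y)).
    apply: le_ln1Dx; rewrite ltr_pdivlMr//; lra.
  apply: (@le_trans _ _ (`|x - y| / y)).
    by rewrite ler_wpM2r ?invr_ge0 ?ler_norm// ltW.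
  by rewrite ler_wpM2l// lef_pV2 ?posrE.
move=> ma mb; rewrite ler_norml half// andbT.
by rewrite lerNl opprB distrC half.
Qed.

Section deviation.
Context {R : realType} (d n : nat).
Local Notation V := (hamming_vertex d n.+1).
Local Notation p := (1 - n.+1%:R^-1 : R).

Lemma card_hamming_vertex : #|V| = (n.+1 ^ d)%N.
Proof. by rewrite card_ffun !card_ord. Qed.

Definition site_dev (a : 'I_n.+1) : R := (a != ord0)%:R - p.

Lemma sum_site_dev : \sum_a site_dev a = 0.
Proof.
rewrite sumrB sumr_const card_ord.
have -> : \sum_(a < n.+1) (a != ord0)%:R = n%:R :> R.
  rewrite big_ord_recl /= add0r (eq_bigr (fun=> 1))// sumr_const card_ord//.
by rewrite -[X in _ - X]mulr_natr mulrBl mulVf ?pnatr_eq0// -natr1; ring.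
Qed.

Lemma site_dev_sqr (a : 'I_n.+1) : site_dev a * site_dev a <= 1.
Proof.
have h0 : 0 <= n.+1%:R^-1 :> R by rewrite invr_ge0.
have h1 : n.+1%:R^-1 <= 1 :> R by rewrite invf_le1 ?ltr0n// ler1n.
by rewrite /site_dev; move: (n.+1%:R^-1) h0 h1 => h h0 h1; case: (a != ord0) => /=; nra.
Qed.

(** Distinct coordinates of a uniform vertex are independent and [site_dev] is centred, so
    covariances vanish; on the diagonal the square is at most 1. *)
Lemma sum_site_dev2 (k l : 'I_d) :
  \sum_(y : V) site_dev (y k) * site_dev (y l) <= (k == l)%:R * (n.+1 ^ d)%:R.
Proof.
have [<-|kl] := eqVneq k l.
  rewrite mul1r -card_hamming_vertex -sum1_card natr_sum.
  by apply: ler_sum => y _; exact: site_dev_sqr.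
(* Padding with factors 1 at the other sites lets the sum over vertices factor over sites. *)
rewrite mul0r; pose F (j : 'I_d) a := if (j == k) || (j == l) then site_dev a else 1.
rewrite (eq_bigr (fun y : V => \prod_j F j (y j))); last first.
  move=> y _; rewrite (bigD1 k)//= (bigD1 l)/=; last by rewrite eq_sym.
  rewrite /F !eqxx orbT /= big1 ?mulr1// => j /andP[/negPf -> /negPf ->].
  by [].
rewrite -bigA_distr_bigA (bigD1 k)//= /F eqxx /=.
by rewrite sum_site_dev mul0r.
Qed.

Lemma hamming_weight_dev (y : V) :
  (hamming_weight y)%:R - p * d%:R = \sum_k site_dev (y k).
Proof.
rewrite sumrB sumr_const card_ord -[X in _ = _ - X]mulr_natr; congr (_ - _).
rewrite /hamming_weight -sum1_card natr_sum big_mkcond /=.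
by apply: eq_bigr => k _; rewrite inE; case: (y k != ord0).
Qed.

Lemma hamming_weight_variance :
  \sum_(y : V) ((hamming_weight y)%:R - p * d%:R) ^+ 2 <= d%:R * (n.+1 ^ d)%:R.
Proof.
under eq_bigr => y _ do rewrite hamming_weight_dev expr2 big_distrlr /=.
have -> : d%:R = \sum_(k < d) 1 :> R by rewrite sumr_const card_ord.
rewrite exchange_big /= mulr_suml.
apply: ler_sum => k _; rewrite exchange_big /= mul1r.
apply: (le_trans (ler_sum _ (fun l _ => sum_site_dev2 k l))).
rewrite -mulr_suml (eq_bigr (fun l => (l == k)%:R)) ?sum_delta ?mul1r// => l _.
by rewrite eq_sym.
Qed.

Lemma hamming_weight_chebyshev (T : R) : 0 < T ->
  #|[set y : V | T <= `|(hamming_weight y)%:R - p * d%:R|]%SET|%:R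
    <= d%:R / T ^+ 2 * (n.+1 ^ d)%:R.
Proof.
move=> T0; rewrite mulrAC ler_pdivlMr ?exprn_gt0//.
apply: le_trans hamming_weight_variance.
rewrite -sum1_card natr_sum mulr_suml big_mkcond /=.
apply: ler_sum => y _; rewrite inE; case: ifP => [h|_]; last exact: sqr_ge0.
by rewrite mul1r -[leRHS]real_normK ?num_real// lerXn2r// nnegrE ltW.
Qed.

(** Full weight means that every coordinate avoids [ord0], leaving [n] letters per site. *)
Lemma card_hamming_weight_max :
  #|[set y : V | hamming_weight y == d]%SET| = (n ^ d)%N.
Proof.
transitivity (#|predC1 (ord0 : 'I_n.+1)| ^ #|'I_d|)%N; last first.
  by rewrite cardC1 !card_ord.
rewrite -card_ffun_on; apply: eq_card => y; rewrite inE.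
apply/idP/ffun_onP => [/eqP h k|h].
  have /setP/(_ k) : [set k | y k != ord0]%SET = [set: 'I_d]%SET.
    by apply/eqP; rewrite eqEcard finset.subsetT cardsT card_ord -/(hamming_weight y) h /=.
  by rewrite !inE.
rewrite /hamming_weight -[X in _ == X]card_ord -cardsT; apply/eqP; congr #|pred_of_set _|.
by apply/setP => k; rewrite !inE; exact: h.
Qed.

(** Both limits rest on this estimate. The arguments of [ln] are at least [m ^+ 2], so each vertex
    costs the distance of its eigenvalue to [l] over [m ^+ 2]: at most [eta] on [G], and at most 2
    elsewhere. *)
Lemma free_energy_dist (J : nat -> R) (m beta l eta : R) (G : {set V}) :
  (0 < n)%N ->
  (forall i, (1 <= i <= d)%N -> 0 <= J i) ->
  \sum_(1 <= i < d.+1) (hamming_valency d n.+1 i)%:R * J i <= 1 ->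
  0 < m -> 0 < beta -> `|l| <= 1 -> 0 <= eta ->
  (forall y, y \in G -> `|gff_eigenvalue d n.+1 J (hamming_weight y) - l| <= eta) ->
  `|ln (gff_partition d n.+1 J m beta) / (n.+1 ^ d)%:R
     - 2^-1 * (ln (2 * pi / beta) - ln (1 + m ^+ 2 - l))|
  <= (2 * m ^+ 2)^-1 * (eta + 2 * (#|~: G|%:R / (n.+1 ^ d)%:R)).
Proof.
move=> n0 J0 J1 m0 b0 l1 eta0 Gl; rewrite ln_gff_partition//.
set N : R := (n.+1 ^ d)%:R.
have N0 : 0 < N by rewrite ltr0n expn_gt0.
have NV : N = \sum_(y : V) 1.
  by rewrite /N -card_hamming_vertex -sum1_card natr_sum.
pose lam (y : V) := gff_eigenvalue d n.+1 J (hamming_weight y).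
have lam1 y : `|lam y| <= 1.
  by apply: normr_gff_eigenvalue => //; rewrite -[X in (_ <= X)%N]card_ord max_card.
have m20 : 0 < m ^+ 2 by rewrite exprn_gt0.
set c := ln (2 * pi / beta); set g := ln (1 + m ^+ 2 - l).
rewrite [X in `|X|](_ : _ = 2^-1 * N^-1 * \sum_y (g - ln (1 + m ^+ 2 - lam y))); last first.
  have -> : \sum_y (g - ln (1 + m ^+ 2 - lam y)) =
      \sum_y ((c - ln (1 + m ^+ 2 - lam y)) - (c - g)).
    by apply: eq_bigr => y _; ring.
  rewrite [in RHS]sumrB.
  have -> : \sum_(y : V) (c - g) = N * (c - g).
    by rewrite NV mulr_suml; apply: eq_bigr => y _; rewrite mul1r.
  by rewrite /lam; field; rewrite gt_eqF.
rewrite normrM (_ : `|2^-1 * N^-1| = 2^-1 * N^-1); last first.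
  by rewrite ger0_norm// mulr_ge0// invr_ge0 ltW.
rewrite (_ : (2 * _)^-1 * _ =
    2^-1 * N^-1 * ((m ^+ 2)^-1 * (N * eta + 2 * #|~: G|%:R))); last first.
  by field; rewrite !gt_eqF.
apply: ler_wpM2l; first by rewrite mulr_ge0// invr_ge0 ltW.
apply: (le_trans (ler_norm_sum _ _ _)).
rewrite NV mulr_suml -sum1_card natr_sum mulr_sumr [X in _ * (_ + X)]big_mkcond /=.
rewrite -big_split /= mulr_sumr; apply: ler_sum => y _.
have /andP[ly1 ly2] : -1 <= lam y <= 1 by rewrite -ler_norml.
have /andP[l1' l2'] : -1 <= l <= 1 by rewrite -ler_norml.
apply: (@le_trans _ _ (`|(1 + m ^+ 2 - l) - (1 + m ^+ 2 - lam y)| / m ^+ 2)).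
  by apply: ler_dist_ln => //; lra.
rewrite mulrC; apply: ler_wpM2l; first by rewrite invr_ge0 ltW.
rewrite [X in `|X|](_ : _ = lam y - l); last by ring.
rewrite inE mul1r; case: ifP => [|/negbFE yG]; last by rewrite addr0 Gl.
by move=> _; rewrite mulr1 (le_trans _ (_ : 2 <= _))// ?lerDr// ler_norml; lra.
Qed.

End deviation.

(** * Limits of the error terms and the two asymptotic regimes *)

Lemma cvg_dist_squeeze {R : realType} (u b : nat -> R) (l : R) :
  (\forall n \near \oo, `|u n - l| <= b n) ->
  b @ \oo --> (0 : R) -> u @ \oo --> l.
Proof.
move=> ub b0; apply: (@squeeze_cvgr _ _ _ _ (fun n => l - b n) (fun n => l + b n)).
- near=> n; have : `|u n - l| <= b n by near: n.
  by rewrite ler_norml => /andP[]; lra.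
- by rewrite -[X in _ --> X]subr0; apply: cvgB => //; exact: cvg_cst.
- by rewrite -[X in _ --> X]addr0; apply: cvgD => //; exact: cvg_cst.
Unshelve. all: by end_near. Qed.

Lemma cvg_norm_le1 {R : realType} (u : nat -> R) (l : R) :
  u @ \oo --> l -> (\forall n \near \oo, `|u n| <= 1) -> `|l| <= 1.
Proof.
move=> ul u1; have nl : (fun n => `|u n|) @ \oo --> `|l| by exact: cvg_norm.
by rewrite -(cvg_lim _ nl)//; apply: limr_le => //; apply/cvg_ex; exists `|l|.
Qed.

Lemma cvg_natV_powR {R : realType} (r : R) : 0 < r ->
  (fun n : nat => (n%:R^-1 : R) `^ r) @ \oo --> (0 : R).
Proof.
move=> r0; rewrite -cvg_shiftS.
(* [powR_cvg0] is a right-hand limit, so the reciprocals must approach 0 through positive values. *)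
have h : (@harmonic R) @ \oo --> 0^'+.
  move=> A A0; have H := @cvg_harmonic R [set y | 0 < y -> A y] A0.
  by apply: (@filterS _ \oo _ _ _ _ H) => k Ak; exact: Ak (harmonic_gt0 k).
exact: cvg_comp h (powR_cvg0 r0).
Qed.

Lemma powR_deviation {R : realType} (d : nat) (delta : R) : (0 < d)%N ->
  d%:R / (d%:R `^ (2^-1 + delta)) ^+ 2 = (d%:R^-1 : R) `^ (2 * delta).
Proof.
move=> d0; have dn0 : d%:R != 0 :> R by rewrite pnatr_eq0 -lt0n.
rewrite -powR_mulrn ?powR_ge0// -powRrM.
rewrite (_ : (2^-1 + delta) * 2 = 1 + 2 * delta); last by field.
rewrite powRD; last by rewrite dn0 implybT.
rewrite powRr1// invfM mulrA divff// mul1r.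
have p0 : d%:R `^ (2 * delta) != 0 :> R by rewrite powR_eq0 (negPf dn0).
by apply: (mulfI p0); rewrite divff// -powRM// divff// powR1.
Qed.

(** [limn] is total and takes a default value on divergent sequences, hence the separate claim of
    convergence. *)
Lemma free_energy_cvg {R : realType} (u : nat -> R) (m beta l : R) :
  0 < beta ->
  u @ \oo --> 2^-1 * (ln (2 * pi / beta) - ln (1 + m ^+ 2 - l)) ->
  cvgn u /\
  - beta^-1 * limn u = (2 * beta)^-1 * (ln (1 + m ^+ 2 - l) - ln (2 * pi / beta)).
Proof.
move=> b0 ul; split; first by apply/cvg_ex; eexists; exact: ul.
by rewrite (cvg_lim _ ul)//; field; rewrite gt_eqF.
Qed.

Unset Implicit Arguments.
Set Strict Implicit.

Theorem corollary3p6 (R : realType)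
    (J : nat -> nat -> nat -> R)
    (J_ge0 : forall d n i : nat, (2 <= d)%N -> (2 <= n)%N ->
       (1 <= i <= d)%N -> 0 <= J d n i)
    (J_le1 : forall d n : nat, (2 <= d)%N -> (2 <= n)%N ->
       \sum_(1 <= i < d.+1) (hamming_valency d n i)%:R * J d n i <= 1)
    (m beta : R) (m_gt0 : 0 < m) (beta_gt0 : 0 < beta) :
  (forall (n : nat) (lstar : R), (2 <= n)%N ->
     (fun d : nat => gff_eigenvalue d n (J d n)
        (Num.truncn ((1 - n%:R^-1) * d%:R : R))) @ \oo --> lstar ->
     (forall eps : R, 0 < eps -> exists2 delta : R, 0 < delta &
        (fun d : nat => \big[Num.max/0]_(i < d.+1 |
             `|i%:R - (1 - n%:R^-1) * d%:R| < eps * d%:R `^ (2^-1 + delta))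
           `|gff_eigenvalue d n (J d n) i - lstar|) @ \oo --> (0 : R)) ->
     let u := fun d : nat =>
       ln (gff_partition d n (J d n) m beta) / (n ^ d)%:R in
     cvgn u /\
     - beta^-1 * limn u =
       (2 * beta)^-1 * (ln (1 + m ^+ 2 - lstar) - ln (2 * pi / beta))) /\
  (forall (d : nat) (lsharp : R), (2 <= d)%N ->
     (fun n : nat => gff_eigenvalue d n (J d n) d) @ \oo --> lsharp ->
     let u := fun n : nat =>
       ln (gff_partition d n (J d n) m beta) / (n ^ d)%:R in
     cvgn u /\
     - beta^-1 * limn u =
       (2 * beta)^-1 * (ln (1 + m ^+ 2 - lsharp) - ln (2 * pi / beta))).
Proof.
have m20 : 0 < m ^+ 2 by rewrite exprn_gt0.
split.
- move=> [//|n] lstar n2 llim hA u; apply: free_energy_cvg => //.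
  have n0 : (0 < n)%N by [].
  (* The limit inherits the bound on the eigenvalues, which keeps [1 + m ^+ 2 - lstar] at least
     [m ^+ 2]. *)
  have l1 : `|lstar| <= 1.
    apply: cvg_norm_le1 llim _; near=> d.
    have d2 : (2 <= d)%N by near: d; exact: nbhs_infty_ge.
    apply: normr_gff_eigenvalue => //; [by move=> i; exact: J_ge0|exact: J_le1|].
    rewrite -(ler_nat R); apply: (@le_trans _ _ ((1 - n.+1%:R^-1) * d%:R)).
      by rewrite Num.Theory.truncn_le mulr_ge0// subr_ge0 invf_le1 ?ltr0n// ler1n.
    by rewrite ler_piMl// lerBlDr lerDl invr_ge0.
  (* With [eps = 1] the window already exceeds the fluctuations of the weight, which are of order at
     most the square root of [d]. *)
  have [delta delta0 hmax] := hA 1 ltr01.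
  set eta := (fun d : nat => _) in hmax.
  apply: (@cvg_dist_squeeze _ _ (fun d : nat => (2 * m ^+ 2)^-1 *
      (eta d + 2 * (d%:R^-1 : R) `^ (2 * delta)))); last first.
    rewrite -[X in _ --> X](mulr0 (2 * m ^+ 2)^-1).
    apply: cvgM; first exact: cvg_cst.
    rewrite -[X in _ --> X]addr0 -[X in _ --> _ + X](mulr0 2).
    apply: cvgD => //; apply: cvgM; first exact: cvg_cst.
    by apply: cvg_natV_powR; rewrite mulr_gt0.
  near=> d.
  have d2 : (2 <= d)%N by near: d; exact: nbhs_infty_ge.
  have d0 : (0 < d)%N by apply: leq_trans d2.
  pose T : R := d%:R `^ (2^-1 + delta).
  have T0 : 0 < T by rewrite powR_gt0// ltr0n.
  pose B := [set y : hamming_vertex d n.+1 |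
    T <= `|(hamming_weight y)%:R - (1 - n.+1%:R^-1) * d%:R|]%SET.
  apply: (le_trans (@free_energy_dist _ _ _ _ _ _ _ (eta d) (~: B)%SET
     n0 _ _ m_gt0 beta_gt0 l1 _ _)).
  + by move=> i; exact: J_ge0.
  + exact: J_le1.
  + exact: bigmax_ge_id.
  + move=> y; rewrite !inE -ltNge => yT.
    have wd : (hamming_weight y < d.+1)%N.
      by rewrite ltnS -[X in (_ <= X)%N]card_ord max_card.
    apply: (@le_bigmax_cond _ _ _ _ (Ordinal wd) _
      (fun i : 'I_d.+1 => `|gff_eigenvalue d n.+1 (J d n.+1) i - lstar|)).
    by rewrite /= mul1r.
  + apply: ler_wpM2l; first by rewrite invr_ge0 mulr_ge0// ltW.
    rewrite lerD2l ler_wpM2l// finset.setCK ler_pdivrMr ?ltr0n ?expn_gt0//.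
    by rewrite -powR_deviation// hamming_weight_chebyshev.
- move=> d lsharp d2 llim u; apply: free_energy_cvg => //.
  have l1 : `|lsharp| <= 1.
    apply: cvg_norm_le1 llim _; exists 2%N => //= -[//|n] n2.
    by apply: normr_gff_eigenvalue => //; [move=> i; exact: J_ge0|exact: J_le1].
  rewrite -cvg_shiftS.
  pose eta n : R := `|gff_eigenvalue d n.+1 (J d n.+1) d - lsharp|.
  (* After the shift there are [n.+1] letters and [harmonic n] is [n.+1%:R^-1], so
     [(1 - harmonic n) ^+ d] is the proportion of vertices of full weight. *)
  apply: (@cvg_dist_squeeze _ _ (fun n : nat => (2 * m ^+ 2)^-1 *
      (eta n + 2 * (1 - (1 - harmonic n) ^+ d)))); last first.
    rewrite -[X in _ --> X](mulr0 (2 * m ^+ 2)^-1).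
    apply: cvgM; first exact: cvg_cst.
    rewrite -[X in _ --> X]addr0 -[X in _ --> _ + X](mulr0 2).
    apply: cvgD => //.
      rewrite /eta -[X in _ --> X](normr0 R) -(subrr lsharp); apply: cvg_norm.
      apply: cvgB; last exact: cvg_cst.
      by move: llim; rewrite -cvg_shiftS.
    apply: cvgM; first exact: cvg_cst.
    rewrite -[X in _ --> X](subrr 1); apply: cvgB; first exact: cvg_cst.
    rewrite -[X in _ --> X](expr1n R d).
    have h1 : (fun n => 1 - harmonic n : R) @ \oo --> (1 : R).
      rewrite -[X in _ --> X]subr0; apply: cvgB; first exact: cvg_cst.
      exact: cvg_harmonic.
    exact: (cvg_comp _ _ h1 (@exprn_continuous R d 1)).
  near=> n.
  have n0 : (0 < n)%N by near: n; exact: nbhs_infty_ge.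
  (* On this set the eigenvalue is exactly the one of index [d], so its error is [eta n]. *)
  pose G := [set y : hamming_vertex d n.+1 | hamming_weight y == d]%SET.
  apply: (le_trans (@free_energy_dist _ _ _ _ _ _ _ (eta n) G
     n0 _ _ m_gt0 beta_gt0 l1 _ _)).
  + by move=> i; exact: J_ge0.
  + exact: J_le1.
  + exact: normr_ge0.
  + by move=> y; rewrite inE => /eqP ->.
  + apply: ler_wpM2l; first by rewrite invr_ge0 mulr_ge0// ltW.
    rewrite lerD2l ler_wpM2l//.
    have N0 : (n.+1 ^ d)%:R != 0 :> R by rewrite pnatr_eq0 expn_eq0.
    rewrite (_ : #|~: G|%:R = (n.+1 ^ d)%:R - (n ^ d)%:R :> R); last first.
      rewrite -(card_hamming_weight_max d n) -card_hamming_vertex -(cardsC G).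
      by rewrite natrD addrC addKr.
    rewrite mulrBl divff// lerD2l lerN2.
    rewrite (_ : 1 - harmonic n = n%:R / n.+1%:R); last first.
      by rewrite /harmonic /= -natr1; field; rewrite natr1 pnatr_eq0.
    by rewrite expr_div_n !natrX.
Unshelve. all: by end_near. Qed.
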